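(* Let $z$ and $c$ be parameters not depending on $q$, and let $n$ be a positive integer. Then \[ \sum_{\pi\in\mathcal{P}(n)}z^{l(\pi)+\#(\pi)-L(\pi)}\left(1-\frac1z\right)^{\nu_d(\pi)-1}\frac{z^{L(\pi)}-c^{L(\pi)}}{z-c}=\sum_{\pi\in\mathcal{P}(n)}c^{l(\pi)-1}z^{\#(\pi)}\left(1-\frac1c\right)^{\nu_d(\pi)-1}L(\pi). \]
   Context: $\mathcal{P}(n)$ is the set of partitions of $n$. For a partition $\pi$: $l(\pi)$ largest part, $L(\pi)$ number of appearances of the largest part, $\#(\pi)$ number of parts, $\nu_d(\pi)$ number of distinct part sizes. *)

(* Defs.v *)
From HB Require Import structures.
From mathcomp Require Import all_boot all_order all_algebra.

Set Implicit Arguments.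
Unset Strict Implicit.
Unset Printing Implicit Defensive.

Definition is_intpart (n : nat) (s : seq nat) : bool :=
  [&& sorted geq s, all (ltn 0) s & sumn s == n].

Record intpart (n : nat) : Type := IntPart {
  parts :> seq nat;
  partsP : is_intpart n parts
}.

HB.instance Definition _ n := [isSub for @parts n].
HB.instance Definition _ n := [Countable of intpart n by <:].

Section IntpartFinite.

Variable n : nat.

Lemma leq_size_sumn (s : seq nat) : all (ltn 0) s -> size s <= sumn s.
Proof.
elim: s => //= x s IHs /andP[x_gt0 s_gt0].
by rewrite -add1n leq_add // IHs.
Qed.

Lemma leq_mem_sumn (s : seq nat) x : x \in s -> x <= sumn s.
Proof.
elim: s => //= y s IHs; rewrite inE => /predU1P[-> | /IHs le_xs].
  exact: leq_addr.
exact: leq_trans le_xs (leq_addl _ _).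
Qed.

(* A partition of n has at most n parts, all of them at most n. *)
Let code (p : intpart n) : n.-bseq 'I_n.+1 :=
  insub_bseq n [seq inord i | i <- p].
Let decode (b : n.-bseq 'I_n.+1) : option (intpart n) :=
  insub [seq val i | i <- b].

Let codeK : pcancel code decode.
Proof.
move=> p; have /and3P[_ p_gt0 /eqP sum_p] := partsP p.
rewrite /decode /code /insub_bseq insubdK; last first.
  by rewrite unfold_in size_map -[leqRHS]sum_p leq_size_sumn.
rewrite -map_comp map_id_in ?valK // => i /leq_mem_sumn le_in /=.
by rewrite inordK // ltnS -sum_p.
Qed.

HB.instance Definition _ := PCanIsFinite codeK : isFinite (intpart n).

End IntpartFinite.

Definition largest_part n (p : intpart n) : nat := \max_(i <- p) i.

Definition mult_largest n (p : intpart n) : nat := count_mem (largest_part p) p.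

Definition num_parts n (p : intpart n) : nat := size p.

Definition num_distinct n (p : intpart n) : nat := size (undup p).

(* Main.v *)
(* Grouping the partitions by their largest part m, and writing (a)_m for
   (1 - a) ... (1 - a q^(m-1)), the two generating functions are
     sum_m z^m q^m (q)_(m-1) / ((zq)_m (1 - c q^m))   and
     sum_m z q^m prod_(1 <= j < m) (c - z q^j) / ((zq)_m (1 - z q^m)).
   Newton interpolation in c at the nodes z q, z q^2, ... gives
     1 / (1 - c q^i) = sum_m q^(i(m-1)) prod_(1 <= j < m) (c - z q^j)
                                        / prod_(1 <= j <= m) (1 - z q^(i+j)).
   Substituting this in the first series and exchanging the sums leaves, with
   w = z q^m, the inner sum
     sum_(i >= 0) w^i (q)_i / (wq)_(i+1) = 1 / (1 - w),
   which telescopes, as does the Newton expansion. *)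
Require Import Defs.
From HB Require Import structures.
From mathcomp Require Import all_boot all_order all_algebra.
From mathcomp Require Import qpoly ring.

Import GRing.Theory.
Local Open Scope ring_scope.

(** * The identity between the two series, for a nilpotent [q] *)

Definition geom_sum {R : comNzRingType} (N : nat) (a : R) : R :=
  \sum_(k < N) a ^+ k.

(** For nilpotent [a] this makes [geom_sum N a] stand for 1/(1 - a), so every denominator becomes a
    factor [g]. *)
Lemma geom_sumE {R : comNzRingType} (N : nat) (a : R) :
  a ^+ N = 0 -> (1 - a) * geom_sum N a = 1.
Proof. by move=> aN; rewrite -opprB mulNr -subrX1 aN sub0r opprK. Qed.

Section NilpotentIdentity.

Variables (R : comNzRingType) (N : nat) (q : R).
Hypothesis qN : q ^+ N = 0.

Let g (a : R) := geom_sum N a.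

Let geomE (a : R) i : (1 - a * q ^+ i.+1) * g (a * q ^+ i.+1) = 1.
Proof.
by apply: geom_sumE; rewrite exprMn -exprM mulnC exprM qN expr0n mulr0.
Qed.

Lemma newton_geom (z c : R) i :
  g (c * q ^+ i.+1) =
  \sum_(m < N) q ^+ (i.+1 * m) * (\prod_(j < m) (c - z * q ^+ j.+1))
     * \prod_(j < m.+1) g (z * q ^+ (i + j).+2).
Proof.
set S := \sum_(m < N) _.
suff SE : (1 - c * q ^+ i.+1) * S = 1.
  by rewrite -[LHS]mulr1 -SE mulrA [g _ * _]mulrC geomE mul1r.
(* [U m] is the remainder after m terms: 1 minus (1 - c q^(i+1)) times the partial sum. The
   differences come from 1 - c q^(i+1) = (1 - z q^(i+m+2)) - q^(i+1) (c - z q^(m+1)), and [U N]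
   vanishes because q^N = 0. *)
pose U m := q ^+ (i.+1 * m) * (\prod_(j < m) (c - z * q ^+ j.+1))
     * \prod_(j < m) g (z * q ^+ (i + j).+2).
have step (m : nat) : (1 - c * q ^+ i.+1) * (q ^+ (i.+1 * m)
     * (\prod_(j < m) (c - z * q ^+ j.+1))
     * \prod_(j < m.+1) g (z * q ^+ (i + j).+2)) = - U m.+1 - - U m.
  rewrite opprK addrC /U !big_ord_recr /= mulnS exprD.
  set a := q ^+ (_ * m); set P := \prod_(j < m) _; set Q := \prod_(j < m) _.
  have := geomE z (i + m).+1; set v := g _ => vE.
  have -> : a * P * Q = a * P * Q * ((1 - z * q ^+ (i + m).+2) * v).
    by rewrite vE mulr1.
  have -> : q ^+ (i + m).+2 = q ^+ i.+1 * q ^+ m.+1.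
    by rewrite -exprD addSn addnS.
  by ring.
transitivity (\sum_(0 <= m < N) (- U m.+1 - - U m)).
  rewrite big_mkord mulr_sumr; apply: eq_bigr => m _; exact: step.
rewrite telescope_sumr // opprK /U mulnC exprM qN expr0n !mul0r oppr0 add0r.
by rewrite muln0 !big_ord0 !mulr1.
Qed.

Lemma sum_qpoch_geom (w : R) : w ^+ N = 0 ->
  \sum_(i < N) w ^+ i * (\prod_(j < i) (1 - q ^+ j.+1))
     * \prod_(j < i.+1) g (w * q ^+ j.+1) = g w.
Proof.
move=> wN; set S := \sum_(i < N) _.
have wE : (1 - w) * g w = 1 by exact: geom_sumE.
suff SE : (1 - w) * S = 1.
  by rewrite -[LHS]mul1r -wE mulrAC SE mul1r.
(* Same scheme, now with 1 - w = (1 - w q^(m+1)) - w (1 - q^(m+1)). *)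
pose U i := w ^+ i * (\prod_(j < i) (1 - q ^+ j.+1))
     * \prod_(j < i) g (w * q ^+ j.+1).
have step (m : nat) : (1 - w) * (w ^+ m * (\prod_(j < m) (1 - q ^+ j.+1))
     * \prod_(j < m.+1) g (w * q ^+ j.+1)) = - U m.+1 - - U m.
  rewrite opprK addrC /U !big_ord_recr /= !exprS.
  set a := w ^+ m; set P := \prod_(j < m) _; set Q := \prod_(j < m) _.
  have := geomE w m; rewrite exprS; set v := g _ => vE.
  have -> : a * P * Q = a * P * Q * ((1 - w * (q * q ^+ m)) * v).
    by rewrite vE mulr1.
  by ring.
transitivity (\sum_(0 <= m < N) (- U m.+1 - - U m)).
  rewrite big_mkord mulr_sumr; apply: eq_bigr => m _; exact: step.
by rewrite telescope_sumr // opprK /U wN !mul0r oppr0 add0r !big_ord0 !mulr1.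
Qed.

Lemma nilpotent_identity (z c : R) :
  \sum_(i < N) z ^+ i.+1 * q ^+ i.+1 * (\prod_(j < i) (1 - q ^+ j.+1))
     * (\prod_(j < i.+1) g (z * q ^+ j.+1)) * g (c * q ^+ i.+1)
  = \sum_(m < N) z * q ^+ m.+1 * (\prod_(j < m) (c - z * q ^+ j.+1))
     * (\prod_(j < m.+1) g (z * q ^+ j.+1)) * g (z * q ^+ m.+1).
Proof.
under eq_bigr => i _ do rewrite (newton_geom z) mulr_sumr.
rewrite exchange_big; apply: eq_bigr => m _ /=.
have wN : (z * q ^+ m.+1) ^+ N = 0.
  by rewrite exprMn -exprM mulnC exprM qN expr0n mulr0.
rewrite -(sum_qpoch_geom _ wN) mulr_sumr; apply: eq_bigr => i _.
(* The first i+m+2 factors can be cut after i+1 of them, as the Newton expansion delivers them, or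
   after m+1, as the inner sum over i needs them. *)
have P1 : (\prod_(j < i.+1) g (z * q ^+ j.+1))
            * \prod_(j < m.+1) g (z * q ^+ (i + j).+2)
        = \prod_(j < i.+1 + m.+1) g (z * q ^+ j.+1) :> R.
  by rewrite big_split_ord /=; congr (_ * _).
have P2 : (\prod_(j < m.+1) g (z * q ^+ j.+1))
            * \prod_(j < i.+1) g (z * q ^+ m.+1 * q ^+ j.+1)
        = \prod_(j < i.+1 + m.+1) g (z * q ^+ j.+1) :> R.
  rewrite addnC big_split_ord /=; congr (_ * _); apply: eq_bigr => j _.
  by rewrite -mulrA -exprD addSn addnS.
transitivity (z ^+ i.+1 * q ^+ i.+1 * q ^+ (i.+1 * m)
   * (\prod_(j < i) (1 - q ^+ j.+1)) * (\prod_(j < m) (c - z * q ^+ j.+1))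
   * \prod_(j < i.+1 + m.+1) g (z * q ^+ j.+1)).
  by rewrite -P1; ring.
rewrite -{}P2 exprMn -exprM !mulSn [(m * i)%N]mulnC !exprD !exprS.
by ring.
Qed.

End NilpotentIdentity.

(** * Partitions as vectors of multiplicities *)

Lemma sum_count_mem (s : seq nat) (N : nat) (F : nat -> nat) :
  all (fun x => 0 < x <= N)%N s ->
  (\sum_(j < N) count_mem j.+1 s * F j.+1 = \sum_(x <- s) F x)%N.
Proof.
elim: s => [_|x s IHs /= /andP[/andP[x_gt0 leN] /IHs {}IHs]].
  by rewrite big_nil big1.
rewrite big_cons -IHs; case: x x_gt0 leN => // x _ ltN.
under eq_bigr do rewrite mulnDl; rewrite big_split /=; congr (_ + _)%N.
rewrite (bigD1 (Ordinal ltN)) //= eqxx mul1n big1 ?addn0 // => j.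
by rewrite eqSS -val_eqE eq_sym /= => /negPf->.
Qed.

Lemma bigmax_cons_mem (x : nat) (s : seq nat) :
  \max_(i <- x :: s) i \in x :: s.
Proof.
elim: s x => [|y s IHs] x; first by rewrite big_seq1 mem_head.
rewrite big_cons inE; case: leqP => _; first by rewrite IHs orbT.
by rewrite eqxx.
Qed.

Section Multiplicities.

Variables (n : nat) (p : intpart n).

Lemma intpart_range : all (fun x => 0 < x <= n)%N p.
Proof.
have /and3P[_ /allP p_gt0 /eqP sum_p] := partsP p.
by apply/allP => x px; rewrite [(0 < x)%N](p_gt0 _ px) -[leqRHS]sum_p leq_mem_sumn.
Qed.

Lemma intpart_range_succ : all (fun x => 0 < x <= n.+1)%N p.
Proof.
apply: sub_all intpart_range => x /andP[-> /=]; exact: leqW.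
Qed.

Lemma num_parts_count : num_parts p = (\sum_(j < n.+1) count_mem j.+1 p)%N.
Proof.
rewrite /num_parts -sum1_size -(sum_count_mem _ n.+1) ?intpart_range_succ //.
by apply: eq_bigr => j _; rewrite muln1.
Qed.

Lemma num_distinct_count :
  num_distinct p = (\sum_(j < n.+1) (0 < count_mem j.+1 p))%N.
Proof.
rewrite /num_distinct -sum1_size -(sum_count_mem _ n.+1); last first.
  by rewrite (eq_all_r (mem_undup p)) intpart_range_succ.
apply: eq_bigr => j _.
by rewrite muln1 count_uniq_mem ?undup_uniq // mem_undup -has_pred1 has_count.
Qed.

Lemma sum_multiplicities : (\sum_(j < n.+1) j.+1 * count_mem j.+1 p = n)%N.
Proof.
have /and3P[_ _ /eqP sum_p] := partsP p.
rewrite -[RHS]sum_p sumnE -(sum_count_mem _ n.+1) ?intpart_range_succ //.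
by apply: eq_bigr => j _; rewrite mulnC.
Qed.

Lemma count_intpart_lt x : (count_mem x p < n.+1)%N.
Proof.
have /and3P[_ p_gt0 /eqP sum_p] := partsP p.
by rewrite ltnS (leq_trans (count_size _ _)) // -[leqRHS]sum_p leq_size_sumn.
Qed.

Lemma largest_part_mem : (0 < n)%N -> largest_part p \in (p : seq nat).
Proof.
have /and3P[_ _ /eqP sum_p] := partsP p; rewrite -[X in (0 < X)%N]sum_p.
by rewrite /largest_part; case: (parts p) => // x s _; exact: bigmax_cons_mem.
Qed.

Lemma leq_largest_part x : x \in (p : seq nat) -> (x <= largest_part p)%N.
Proof. by move=> px; rewrite /largest_part; apply: (@leq_bigmax_seq _ _ xpredT id). Qed.

End Multiplicities.

(** Index [j] stands for the part size j+1. The size n+1 never occurs; admitting it lets indices and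
    values share one type. *)
Definition multiplicities n (p : intpart n) : {ffun 'I_n.+1 -> 'I_n.+1} :=
  [ffun j => inord (count_mem (val j).+1 (p : seq nat))].

Lemma multiplicitiesE n (p : intpart n) j :
  multiplicities n p j = count_mem (val j).+1 (p : seq nat) :> nat.
Proof. by rewrite ffunE inordK // count_intpart_lt. Qed.

Lemma multiplicities_inj n : injective (multiplicities n).
Proof.
move=> p p' eq_pp'; apply: val_inj => /=.
have /and3P[sp _ _] := partsP p; have /and3P[sp' _ _] := partsP p'.
have count0 (r : intpart n) x : ~~ (0 < x <= n)%N -> count_mem x r = 0%N.
  move=> xNr; apply: count_memPn; apply: contra xNr.
  exact: (allP (intpart_range n r)).
apply: (@sorted_eq _ geq) => //.
- by move=> x y z /= yx xz; apply: leq_trans xz yx.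
- by move=> x y /=; rewrite andbC => /anti_leq.
apply/allP => x _ /=; apply/eqP.
have [/andP[]|xN] := boolP (0 < x <= n)%N; last by rewrite !count0.
case: x => // x _ lexn.
by rewrite -(multiplicitiesE n p (Ordinal (leqW lexn))) eq_pp' multiplicitiesE.
Qed.

Lemma multiplicities_codom n :
  [set multiplicities n p | p : intpart n]
  = [set f : {ffun 'I_n.+1 -> 'I_n.+1} | (\sum_(j < n.+1) j.+1 * f j)%N == n].
Proof.
apply/setP => f; rewrite inE; apply/imsetP/eqP => [[p _ ->]|sum_f].
  by rewrite -[RHS](sum_multiplicities _ p); apply: eq_bigr => j _; rewrite multiplicitiesE.
pose s := sort geq (flatten [seq nseq (f j) (val j).+1 | j <- enum 'I_n.+1]).
have count_s (i : 'I_n.+1) : count_mem i.+1 s = f i.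
  rewrite /s (permP (permEl (perm_sort _ _))) count_flatten -map_comp sumnE.
  rewrite big_map big_enum /= (bigD1 i) //= count_nseq /= eqxx mul1n.
  rewrite big1 ?addn0 // => j ji; rewrite count_nseq /= eqSS.
  by rewrite val_eqE (negPf ji).
have s_range : all (fun x => 0 < x <= n.+1)%N s.
  rewrite /s (perm_all _ (permEl (perm_sort _ _))).
  apply/allP => x /flatten_mapP[j _ /nseqP[-> _]]; exact: ltn_ord.
have sP : is_intpart n s.
  apply/and3P; split.
  - by apply: sort_sorted => x y /=; exact: leq_total.
  - by apply: sub_all s_range => x /andP[].
  - rewrite sumnE -(sum_count_mem _ n.+1) // -[X in _ == X]sum_f; apply/eqP.
    by apply: eq_bigr => j _; rewrite count_s mulnC.
exists (IntPart sP) => //; apply/ffunP => j; apply: val_inj.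
by rewrite /= multiplicitiesE count_s.
Qed.

(** Expanding the product picks one multiplicity for each size, and the choices of total degree n
    are exactly the multiplicity vectors of partitions of n. *)
Lemma sum_intpart_prod (R : comNzRingType) n (G : nat -> nat -> R) :
  \sum_(p : intpart n) \prod_(j < n.+1) G j (count_mem j.+1 p)
  = (\prod_(j < n.+1) \sum_(k < n.+1) (G j k)%:P * 'X^(j.+1 * k))`_n.
Proof.
rewrite bigA_distr_bigA coef_sum /=.
have coefE (f : {ffun 'I_n.+1 -> 'I_n.+1}) :
    (\prod_(j < n.+1) ((G j (f j))%:P * 'X^(j.+1 * f j)))`_n
  = if f \in [set multiplicities n p | p : intpart n]
    then \prod_(j < n.+1) G j (f j) else 0.
  rewrite multiplicities_codom inE big_split /= -rmorph_prod /=.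
  rewrite -(big_morph _ (@exprD {poly R} 'X) (expr0 _)) coefCM coefXn eq_sym.
  by case: eqP => _; rewrite ?mulr1 ?mulr0.
under [RHS]eq_bigr do rewrite coefE.
rewrite -big_mkcond big_imset; last by move=> p p' _ _; apply: multiplicities_inj.
by apply: eq_bigr => p _; apply: eq_bigr => j _; rewrite multiplicitiesE.
Qed.

(** * Generating functions grouped by the largest part *)

Section WeightedSum.

Variables (R : comNzRingType) (n : nat) (A : nat -> nat -> R) (x y : R).
Hypotheses (n_gt0 : (0 < n)%N) (A0 : forall m, A m 0%N = 0).

Let B (k : nat) : R := if k == 0%N then 1 else y * x ^+ k.

(** Local weights when the largest part is m+1: a smaller size gives x per copy and y once if
    present, the largest gives [A], and a larger size must be absent. *)
Let G (m j k : nat) : R :=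
  if (j < m)%N then B k else if j == m then A m k else (k == 0%N)%:R.

(** Only m = [largest_part p] - 1 survives: for smaller m a forbidden size is present, and for
    larger m the size m+1 is absent, so [A0] applies. *)
Lemma intpart_weightE (p : intpart n) :
  A (largest_part p - 1) (mult_largest p) *
    x ^+ (num_parts p - mult_largest p) * y ^+ (num_distinct p - 1)
  = \sum_(m < n.+1) \prod_(j < n.+1) G m j (count_mem j.+1 p).
Proof.
rewrite /G; have lp := largest_part_mem n p n_gt0.
have /andP[l_gt0 l_le] := allP (intpart_range n p) _ lp.
have [l lE] : exists l : 'I_n.+1, largest_part p = l.+1.
  by exists (inord (largest_part p).-1); rewrite inordK ?prednK // ltnW.
have c_gt j : (l < j)%N -> count_mem j.+1 p = 0%N.
  move=> lj; apply/count_memPn; apply: contraL lj => /leq_largest_part.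
  by rewrite lE ltnS -leqNgt.
have c_l : (0 < count_mem l.+1 p)%N by rewrite -has_count has_pred1 -lE.
rewrite /mult_largest lE subSS subn0 (bigD1 l) //= [X in _ + X]big1 ?addr0; last first.
  move=> m ml; case: (ltngtP m l) => [ltml|ltlm|/val_inj eqml].
  - rewrite (bigD1 l) //= ltnNge (ltnW ltml) /= gtn_eqF //.
    by rewrite eqn0Ngt c_l mul0r.
  - by rewrite (bigD1 m) //= ltnn eqxx c_gt // A0 mul0r.
  - by rewrite eqml eqxx in ml.
rewrite (bigD1 l) //= ltnn eqxx -mulrA; congr (_ * _).
rewrite num_parts_count num_distinct_count (bigD1 l) //= addKn.
rewrite [X in (X - 1)%N](bigD1 l) //= c_l addKn.
rewrite !expr_sum -big_split /=; apply: eq_bigr => j jl.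
case: (ltngtP j l) => [ltjl|ltlj|/val_inj eqjl]; last by rewrite eqjl eqxx in jl.
- by rewrite /B; case: (count_mem _ _) => [|k]; rewrite ?mulr1 // mulrC expr1.
- by rewrite c_gt // mulr1.
Qed.

Lemma sum_intpart_weight :
  \sum_(p : intpart n) A (largest_part p - 1) (mult_largest p) *
    x ^+ (num_parts p - mult_largest p) * y ^+ (num_distinct p - 1)
  = (\sum_(m < n.+1) (\sum_(k < n.+1) (A m k)%:P * 'X^(m.+1 * k)) *
       \prod_(j < m) \sum_(k < n.+1) (B k)%:P * 'X^(j.+1 * k))`_n.
Proof.
under eq_bigr do rewrite intpart_weightE.
rewrite exchange_big coef_sum /=; apply: eq_bigr => m _.
rewrite (sum_intpart_prod _ _ (G m)); congr (nth 0 (polyseq _) n).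
pose S (j : nat) : {poly R} := \sum_(k < n.+1) (G m j k)%:P * 'X^(j.+1 * k).
rewrite -(big_mkord xpredT S) (big_cat_nat (n := m)) ?(ltnW (ltn_ord m)) //=.
rewrite big_mkord big_ltn // [X in _ * (_ * X)]big_nat [X in _ * (_ * X)]big1.
  rewrite mulr1 [LHS]mulrC; congr (_ * _); first by rewrite /S /G ltnn eqxx.
  by apply: eq_bigr => j _; rewrite /S /G ltn_ord.
(* A size above m+1 keeps only its term k = 0, hence contributes a factor 1. *)
move=> j /andP[mj _]; rewrite /S /G ltnNge (ltnW mj) /= gtn_eqF //.
rewrite big_ord_recl /= muln0 expr0 mulr1 big1 ?addr0 // => k _.
by rewrite mul0r.
Qed.

End WeightedSum.

(** * Closed forms of the factors in the truncated ring *)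

Lemma sum_mulrn_geom {R : comNzRingType} (N : nat) (a : R) : a ^+ N = 0 ->
  \sum_(k < N) a ^+ k *+ k = a * geom_sum N a ^+ 2.
Proof.
move=> aN; have gE := geom_sumE N a aN.
suff SE : (1 - a) * (\sum_(k < N) a ^+ k *+ k) = a * geom_sum N a.
  by rewrite -[LHS]mul1r -gE mulrAC SE expr2 mulrA.
(* Here (1 - a) k a^k = (k a^k - (k+1) a^(k+1)) + a^(k+1): a telescoping part and a geometric
   one. *)
transitivity (\sum_(0 <= k < N) (- (a ^+ k.+1 *+ k.+1) - - (a ^+ k *+ k)) +
              \sum_(0 <= k < N) a ^+ k.+1).
  rewrite -big_split big_mkord mulr_sumr; apply: eq_bigr => k _ /=.
  by rewrite mulrSr exprS mulrBl mul1r -mulrnAr; ring.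
rewrite telescope_sumr // aN mul0rn !mulr0n oppr0 subr0 add0r big_mkord.
by rewrite mulr_sumr; apply: eq_bigr => k _; rewrite exprS.
Qed.

(* T is F[X] / X^(n+1), in which every geometric series is a finite sum. *)
Lemma truncation (F : fieldType) (n : nat) :
  exists (T : comNzRingType) (tr : {rmorphism {poly F} -> T}),
    tr 'X ^+ n.+1 = 0 /\ forall P Q, tr P = tr Q -> P`_n = Q`_n.
Proof.
exists {poly %/ ('X^(n.+1) : {poly F})}, (in_qpoly 'X^(n.+1)).
split=> [|P Q /(congr1 val) /=]; last first.
  rewrite mk_monic_Xn -!Pdiv.RingMonic.take_poly_rmodp => /(congr1 (coefp n)).
  by rewrite /= !coef_take_poly ltnSn.
rewrite -rmorphXn; apply: val_inj => /=.
by rewrite mk_monic_Xn -Pdiv.RingMonic.take_poly_rmodp -['X^_]mul1r take_polyMXn_0.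
Qed.

Section SeriesImages.

Variables (F : fieldType) (n : nat) (T : comNzRingType).
Variable tr : {rmorphism {poly F} -> T}.
Hypothesis X_nilpotent : tr 'X ^+ n.+1 = 0.

Local Notation q := (tr 'X).
Local Notation const a := (tr a%:P).
Local Notation g := (geom_sum n.+1).

Lemma const_mulX_nilpotent a j : (const a * q ^+ j.+1) ^+ n.+1 = 0.
Proof. by rewrite exprMn -exprM mulnC exprM X_nilpotent expr0n mulr0. Qed.

Lemma const_mulX_geom a j :
  (1 - const a * q ^+ j.+1) * g (const a * q ^+ j.+1) = 1.
Proof. exact/geom_sumE/const_mulX_nilpotent. Qed.

Lemma morph_geom_term a j k :
  tr ((a ^+ k)%:P * 'X^(j * k)) = (const a * q ^+ j) ^+ k.
Proof. by rewrite rmorphM !rmorphXn /= exprMn -exprM. Qed.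

Lemma morph_geom a j :
  tr (\sum_(k < n.+1) (a ^+ k)%:P * 'X^(j * k)) = g (const a * q ^+ j).
Proof.
by rewrite rmorph_sum; apply: eq_bigr => k _; exact: morph_geom_term.
Qed.

(** With u = x q^(j+1), the sum is (1 - y) + y/(1 - u) = (1 - (1 - y) u)/(1 - u). For x = z, the
    choice y = 1 - 1/z gives the numerator 1 - q^(j+1), and y = 1 - 1/c gives 1 - (z/c) q^(j+1). *)
Lemma morph_geom_affine x y j :
  tr (\sum_(k < n.+1) (if k == 0 :> nat then 1 else y * x ^+ k)%:P
            * 'X^(j.+1 * k))
  = (1 - const ((1 - y) * x) * q ^+ j.+1) * g (const x * q ^+ j.+1).
Proof.
transitivity (const (1 - y) + const y * g (const x * q ^+ j.+1)).
  rewrite -morph_geom -rmorphM -rmorphD; congr (tr _).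
  rewrite !big_ord_recl /= !muln0 !expr0 !mulr1 mulrDr mulr1 addrA -polyCD subrK.
  congr (_ + _); rewrite mulr_sumr; apply: eq_bigr => k _.
  by rewrite polyCM mulrA.
rewrite -[X in X + _]mulr1 -{1}(const_mulX_geom x j).
rewrite polyCM polyCB rmorphM rmorphB /= rmorph1.
by ring.
Qed.

(** Partial fractions: 1/(1 - za) - 1/(1 - ca) = (z - c) a / ((1 - za)(1 - ca)) with a = q^(m+1). *)
Lemma morph_geom_diff z c m : z != c ->
  tr (\sum_(k < n.+1) ((z ^+ k - c ^+ k) / (z - c))%:P * 'X^(m.+1 * k))
  = q ^+ m.+1 * g (const z * q ^+ m.+1) * g (const c * q ^+ m.+1).
Proof.
move=> zc; have zBc : z - c != 0 by rewrite subr_eq0.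
transitivity (const (z - c)^-1
              * (g (const z * q ^+ m.+1) - g (const c * q ^+ m.+1))).
  rewrite -!morph_geom -rmorphB -rmorphM -sumrB mulr_sumr; congr (tr _).
  apply: eq_bigr => k _; rewrite mulrC [_ / _]mulrC polyCM polyCB; ring.
have uE : const (z - c)^-1 * (const z - const c) = 1.
  by rewrite -rmorphB -polyCB -rmorphM -polyCM mulVf // rmorph1.
have zE := const_mulX_geom z m; have cE := const_mulX_geom c m.
set a := q ^+ _ in zE cE *; set gz := g _ in zE *; set gc := g _ in cE *.
have -> : gz - gc = gz * ((1 - const c * a) * gc) - gc * ((1 - const z * a) * gz).
  by rewrite cE zE !mulr1.
rewrite -[RHS]mul1r -uE; ring.
Qed.

Lemma morph_geom_mulrn z m :
  tr (\sum_(k < n.+1) (z ^+ k *+ k)%:P * 'X^(m.+1 * k))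
  = const z * q ^+ m.+1 * g (const z * q ^+ m.+1) ^+ 2.
Proof.
rewrite -sum_mulrn_geom ?const_mulX_nilpotent // rmorph_sum.
apply: eq_bigr => k _.
by rewrite polyCMn mulrnAl rmorphMn /= morph_geom_term.
Qed.

End SeriesImages.

Theorem theorem2p15 (F : fieldType) (z c : F) (n : nat)
    (hz : z != 0) (hc : c != 0) (hzc : z != c) (hn : (0 < n)%N) :
  \sum_(p : intpart n)
     z ^+ (largest_part p + num_parts p - mult_largest p)
     * (1 - 1 / z) ^+ (num_distinct p - 1)
     * ((z ^+ mult_largest p - c ^+ mult_largest p) / (z - c))
  = \sum_(p : intpart n)
     c ^+ (largest_part p - 1) * z ^+ num_parts p
     * (1 - 1 / c) ^+ (num_distinct p - 1) * (mult_largest p)%:R.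
Proof.
have L_le (p : intpart n) : (mult_largest p <= num_parts p)%N by exact: count_size.
(* [AL] and [AR] collect all that depends on the largest part m+1 and its multiplicity k. The other
   parts then carry x = z on both sides, with y = 1 - 1/z on the left and y = 1 - 1/c on the
   right. *)
pose AL m k := z ^+ m.+1 * ((z ^+ k - c ^+ k) / (z - c)).
pose AR m k := c ^+ m * (z ^+ k *+ k).
have AL0 m : AL m 0%N = 0 by rewrite /AL subrr mul0r mulr0.
have AR0 m : AR m 0%N = 0 by rewrite /AR mulr0n mulr0.
transitivity (\sum_(p : intpart n) AL (largest_part p - 1)%N (mult_largest p)
   * z ^+ (num_parts p - mult_largest p) * (1 - 1 / z) ^+ (num_distinct p - 1)).
  apply: eq_bigr => p _; have lp := largest_part_mem n p hn.
  have /andP[l_gt0 _] := allP (intpart_range n p) _ lp.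
  rewrite /AL (subn1 (largest_part p)) prednK // -addnBA // exprD; ring.
transitivity (\sum_(p : intpart n) AR (largest_part p - 1)%N (mult_largest p)
   * z ^+ (num_parts p - mult_largest p) * (1 - 1 / c) ^+ (num_distinct p - 1));
  last first.
  apply: eq_bigr => p _.
  rewrite /AR -{2}(subnKC (L_le p)) exprD -mulr_natr; ring.
rewrite !sum_intpart_weight //.
have [T [tr [qN coef_tr]]] := truncation F n; apply: coef_tr.
rewrite !rmorph_sum.
pose q := tr 'X; pose Z := tr z%:P; pose C := tr c%:P.
pose g := @geom_sum T n.+1.
transitivity (\sum_(i < n.+1) Z ^+ i.+1 * q ^+ i.+1
     * (\prod_(j < i) (1 - q ^+ j.+1))
     * (\prod_(j < i.+1) g (Z * q ^+ j.+1)) * g (C * q ^+ i.+1)).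
  apply: eq_bigr => m _; rewrite rmorphM rmorph_prod.
  have -> : tr (\sum_(k < n.+1) (AL m k)%:P * 'X^(m.+1 * k))
      = Z ^+ m.+1 * (q ^+ m.+1 * g (Z * q ^+ m.+1) * g (C * q ^+ m.+1)).
    rewrite -(morph_geom_diff _ _ _ _ qN _ _ m hzc) -rmorphXn -polyC_exp -rmorphM mulr_sumr.
    by congr (tr _); apply: eq_bigr => k _; rewrite mulrA -polyCM.
  rewrite big_ord_recr /=.
  under eq_bigr => j _.
    rewrite (morph_geom_affine _ _ _ _ qN) subKr div1r mulVf // rmorph1 mul1r; over.
  rewrite big_split /= /g; ring.
rewrite (nilpotent_identity _ _ _ qN); apply: eq_bigr => m _.
rewrite rmorphM rmorph_prod.
have -> : tr (\sum_(k < n.+1) (AR m k)%:P * 'X^(m.+1 * k))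
    = C ^+ m * (Z * q ^+ m.+1 * g (Z * q ^+ m.+1) ^+ 2).
  rewrite -(morph_geom_mulrn _ _ _ _ qN) -rmorphXn -polyC_exp -rmorphM mulr_sumr.
  by congr (tr _); apply: eq_bigr => k _; rewrite mulrA -polyCM.
(* The power c^m coming from the largest part m+1 clears the denominators c of the m numerators 1 -
   (z/c) q^(j+1). *)
have -> : \prod_(j < m) (C - Z * q ^+ j.+1)
    = C ^+ m * \prod_(j < m) (1 - tr (c^-1 * z)%:P * q ^+ j.+1).
  have -> : C ^+ m = \prod_(j < m) C by rewrite prodr_const card_ord.
  rewrite -big_split; apply: eq_bigr => j _ /=.
  by rewrite mulrBr mulr1 mulrA -rmorphM -polyCM mulrA mulfV // mul1r.
rewrite big_ord_recr /=.
under [X in _ = _ * X]eq_bigr => j _.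
  rewrite (morph_geom_affine _ _ _ _ qN) subKr div1r; over.
rewrite big_split /= /g; ring.
Qed.
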